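(* Let $X$ be a $\mathbb{Z}$-subshift with positive topological entropy, let $\mu$ be a measure of maximal entropy of $X$, and let $v,w\in L(X)$ (the lengths $|v|$ and $|w|$ may differ). If $E_X(v)\subseteq E_X(w)$, then $$\mu(v)\leq \mu(w)\,e^{h_{top}(X)(|w|-|v|)}.$$
   Context: Let $\mathcal{A}$ be a finite alphabet; $\mathcal{A}^{\mathbb{Z}}$ has the product topology and shift maps $(\sigma_n x)_i=x_{i+n}$. A $\mathbb{Z}$-subshift is a (nonempty) closed set $X\subseteq\mathcal{A}^{\mathbb{Z}}$ with $\sigma_n(X)=X$ for all $n\in\mathbb{Z}$. For $n\ge 1$, $L_n(X)=\{x_{[0,n)}: x\in X\}$ is the set of words of length $n$ occurring in points of $X$, and $L(X)=\bigcup_{n\ge 1}L_n(X)$. For $w\in L_n(X)$, $|w|=n$ is its length and $[w]=\{x\in X: x_{[0,n)}=w\}$ its cylinder set. The topological entropy is $h_{top}(X)=\lim_{n\to\infty}\frac1n\log|L_n(X)|$. All measures are shift-invariant Borel probability measures on $X$, and $\mu(w):=\mu([w])$. The entropy of $\mu$ is $h_\mu(X)=\lim_{n\to\infty}\frac1n\sum_{w\in\mathcal{A}^n}-\mu(w)\log\mu(w)$, and $\mu$ is a measure of maximal entropy (MME) if $h_\mu(X)=h_{top}(X)$. Extender set: for $w\in L_n(X)$, $E_X(w)$ is the set of all bi-infinite sequences $y\in\mathcal{A}^{\mathbb{Z}}$ obtained from points $x\in[w]$ by deleting $w$ and concatenating the two sides: $y_i=x_i$ for $i<0$ and $y_i=x_{i+n}$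 for $i\ge 0$. With this identification, extender sets of words of different lengths can be compared. *)

(* Defs.v *)
From HB Require Import structures.
From mathcomp Require Import all_boot all_order all_algebra.
From mathcomp Require Import all_classical all_reals all_analysis.

Set Implicit Arguments.
Unset Strict Implicit.
Unset Printing Implicit Defensive.

Import Order.TTheory GRing.Theory Num.Theory.
Import numFieldNormedType.Exports.
Local Open Scope classical_set_scope.
Local Open Scope ring_scope.

(* Measurable types are pointed in this library, so alphabets are finite types
   with a distinguished letter; nonempty subshifts need a nonempty alphabet
   anyway, and the distinguished letter plays no role below. *)
#[short(type="alphabetType")]
HB.structure Definition Alphabet := {A of Finite A & Pointed A}.

Definition config (A : alphabetType) : Type :=
  {ptws int -> discrete_topology A}.

HB.instance Definition _ (A : alphabetType) := Topological.on (config A).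
HB.instance Definition _ (A : alphabetType) :=
  isPointed.Build (config A) (fun=> point).
HB.instance Definition _ (A : alphabetType) :=
  @isMeasurable.Build (sigma_display (@open (config A))) (config A)
    <<s @open (config A) >> (@sigma_algebra0 _ setT _) (@sigma_algebraC _ _)
    (@sigma_algebra_bigcup _ setT _).

Section Subshifts.
Context {A : alphabetType}.
Implicit Types (X : set (config A)) (x : config A).

Definition zshift (n : int) x : config A := fun i => x (i + n).

Definition is_subshift X :=
  [/\ X !=set0, closed X & forall n : int, zshift n @` X = X].

Definition prefix_word (n : nat) x : n.-tuple A := [tuple x i%:Z | i < n].

Definition lang X (n : nat) : set (n.-tuple A) := prefix_word n @` X.

Definition cylinder X n (w : n.-tuple A) : set (config A) :=
  [set x | X x /\ prefix_word n x = w].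

Definition excise (n : nat) x : config A :=
  fun i => if i < 0 then x i else x (i + n%:Z).

Definition extender X n (w : n.-tuple A) : set (config A) :=
  excise n @` cylinder X w.

End Subshifts.
Arguments lang {A} X n _.

Section Entropy.
Context {R : realType} {A : alphabetType}.
Implicit Types (X : set (config A)) (mu : probability (config A) R).

(* Both limits below exist by subadditivity, for [X] a subshift and [mu]
   shift-invariant; the term of index [0] is [0] since [0^-1 = 0]. *)
Definition htop X : R :=
  limn (fun n : nat => n%:R^-1 * ln (#|lang X n|%:R : R)).

(* The convention [0 log 0 = 0] holds since [0 * _ = 0]. *)
Definition hmeas X mu : R :=
  limn (fun n : nat => n%:R^-1 * \sum_(w : n.-tuple A)
    - (fine (mu (cylinder X w)) * ln (fine (mu (cylinder X w))))).

(* Borel probability measures on [X] are represented by the Borel probability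
   measures on the full shift giving full mass to [X]. *)
Definition is_invariant_on X mu :=
  mu X = 1%E /\
  forall (n : int) (B : set (config A)), measurable B ->
    mu (zshift n @^-1` B) = mu B.

Definition is_MME X mu := is_invariant_on X mu /\ hmeas X mu = htop X.

End Entropy.
Arguments htop R {A} X.

(* Main.v *)
Require Import Defs.
From HB Require Import structures.
From mathcomp Require Import all_boot all_order all_algebra.
From mathcomp Require Import all_classical all_reals all_analysis.
From mathcomp Require Import zify ring lra.

Import Order.TTheory GRing.Theory Num.Theory.
Import numFieldNormedType.Exports.
Local Open Scope classical_set_scope.
Local Open Scope ring_scope.

(** The inclusion of extender sets says that an occurrence of v in a point of X
    may be replaced by w. Take a word x of length N at random according to mu:
    it has on average about N mu(v) occurrences of v and N mu(w) of w.
    Replace in it a small proportion t of the occurrences of v. The choice of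
    the replaced occurrences contributes entropy, and x can be recovered from
    the resulting word y together with the set of those occurrences of w in y
    that are new. To first order in t, the entropy gained exceeds the entropy
    needed for the recovery by t N mu(v) log (mu(v) / mu(w)), while the length
    grows by t N mu(v) (|w| - |v|). The entropy of x is about N h, and y ranges
    over words of X, of which there are about e^(h |y|); hence
    log (mu(v) / mu(w)) <= h (|w| - |v|).

    The proof below replaces random choices by weights. A word with a set of
    chosen disjoint occurrences of v is a marked word z; filling the marks of z
    with v gives x and filling them with w gives y. Give z the weight
    b^|y| t^(number of marks) / (1 + t)^(occurrences of w in y). For a given y
    the total weight is at most b^|y| (marking_sum_le), so that for b slightly
    below e^(-h) the marked words for which y occurs in X have bounded total
    weight (bounded_growth), whatever N is. For a given x in L(X), all its
    marked words are of this kind (fill_replace) and their weight is at least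
    b^N (1 + s')^(occurrences of v in x) / (1 + t)^(occurrences of w in x),
    where s' is equivalent to t b^(|w| - |v|) as t tends to 0
    (full_marking_sum_ge, occ_fill). These two estimates make up
    weighted_count_le.

    The inequality of Gibbs (gibbs) bounds the entropy of x plus the mean of the
    logarithm of such a weight by the logarithm of the total weight. The mean
    numbers of occurrences are N mu(v) and N mu(w) up to bounded errors, by
    linearity and shift invariance (mean_occ_ge, mean_occ_le), and the entropy
    of x is at least N (h - d) for large N because mu has maximal entropy.
    Division by N gives mu(v) log (1 + s') <= mu(w) log (1 + t) + 3 d
    (replacement_rate). With d = t^2, division by t and t -> 0 end the proof. *)

(** * Occurrences of a word in a word *)
Section Occurrences.
Context {A : eqType}.
Implicit Types (a : A) (v w x y : seq A).

Fixpoint num_occ w x : nat :=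
  (prefix w x + (if x is _ :: x' then num_occ w x' else 0))%N.

Lemma occ_cons w a x : num_occ w (a :: x) = (prefix w (a :: x) + num_occ w x)%N.
Proof. by []. Qed.

Lemma occ_nil w : (0 < size w)%N -> num_occ w [::] = 0%N.
Proof. by case: w. Qed.

Lemma leq_occ_cat w y x : (num_occ w x <= num_occ w (y ++ x))%N.
Proof. by elim: y => //= a y IH; apply: leq_trans IH (leq_addl _ _). Qed.

Lemma occ_cat_leq w y x : (num_occ w (y ++ x) <= size y + num_occ w x)%N.
Proof.
elim: y => //= a y IH; rewrite addSn -add1n; apply: leq_add IH.
exact: leq_b1.
Qed.

Lemma occ_drop w k x : (num_occ w (drop k x) <= num_occ w x)%N.
Proof. by rewrite -{2}(cat_take_drop k x) leq_occ_cat. Qed.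

Lemma num_occE w x :
  (0 < size w)%N -> num_occ w x = (\sum_(i < size x) prefix w (drop i x))%N.
Proof.
move=> w0; elim: x => [|a x IH]; first by rewrite big_ord0 occ_nil.
by rewrite occ_cons big_ord_recl drop0 IH.
Qed.

End Occurrences.

(** * Marked words and replacement *)
Local Arguments prefix : simpl never.

Section Markings.
Context {A : finType}.
Implicit Types (a : A) (u v w x y : seq A) (z : seq (option A)).

(** In a marked word, [Some a] is a letter and [None] a mark. Marked words [z]
    with [fill v z = x] are the choices of pairwise disjoint occurrences of [v]
    in [x], and [fill w z] is [x] with the chosen occurrences replaced by [w].
    This description treats [v] and [w] alike: the inverse replacement is given
    by the same [z], even if the lengths of [v] and [w] differ or if these words
    overlap themselves. *)
Definition fill v z : seq A :=
  flatten [seq if c is Some a then [:: a] else v | c <- z].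

Definition marks z : nat := count_mem None z.

Lemma size_fill v z :
  (size (fill v z) + marks z = size z + size v * marks z)%N.
Proof.
rewrite /fill /marks; elim: z => [|[a|] z IH] /=; first by rewrite muln0.
  by rewrite add0n addSn IH.
move: IH; rewrite size_cat mulnDr muln1.
by move: (size (flatten _)) (count _ z) (size v * _)%N => f c p; lia.
Qed.

(** The marks are filled with [w] one at a time, from left to right; [u] is the
    part that has already been treated. *)
Lemma fill_replace (L : seq A -> Prop) v w :
  (forall u r, L (u ++ v ++ r) -> L (u ++ w ++ r)) ->
  forall z, L (fill v z) -> L (fill w z).
Proof.
move=> Lvw z; rewrite -[fill v z]cat0s -[fill w z]cat0s.
elim: z [::] => [//|[a|] z IH] u.
  by rewrite -!(cat_rcons a u (fill _ z)); apply: IH.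
by move=> /Lvw; rewrite !catA; exact: IH.
Qed.

Lemma take_fill v w k z :
  (k <= index None z)%N -> take k (fill v z) = take k (fill w z).
Proof.
rewrite /fill; elim: z k => [|[a|] z IH] [|k] //=.
  by rewrite ltnS => /IH ->.
by rewrite !take0.
Qed.

Lemma fill_noNone v w z : None \notin z -> fill v z = fill w z.
Proof.
rewrite /fill; elim: z => [|[a|] z IH] //=.
by rewrite inE /= => /IH ->.
Qed.

(** Bounds the number of letters which, when put in front of [z], start a window
    of length [k] that meets the first mark of [z]. *)
Definition reach k z : nat := if None \in z then (k - index None z)%N else 0%N.

(** A new block [w] creates at most [size w] occurrences starting in it, and at
    most [size w] starting before it and meeting it; all other occurrences of
    [w] are read off letters common to both words. In the induction, which adds
    letters on the left, [reach] is the part of the second allowance of the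
    first mark that has not been spent. *)
Lemma occ_fill_reach v w z :
  (num_occ w (fill w z) + reach (size w) z <=
   num_occ w (fill v z) + 2 * size w * marks z)%N.
Proof.
elim: z => [|[a|] z IH]; first by rewrite /fill /reach /= muln0.
- have -> : marks (Some a :: z) = marks z by [].
  rewrite -[fill w _]/(a :: fill w z) -[fill v _]/(a :: fill v z) !occ_cons.
  have [r0|r_gt0] := posnP (reach (size w) z); last first.
    have : (reach (size w) (Some a :: z) < reach (size w) z)%N.
      move: r_gt0; rewrite /reach inE /=; case: (None \in z) => //; lia.
    have : (prefix w (a :: fill w z) <= 1)%N by exact: leq_b1.
    lia.
  have -> : reach (size w) (Some a :: z) = 0%N.
    move: r0; rewrite /reach inE /=; case: (None \in z) => //; lia.
  have -> : prefix w (a :: fill w z) = prefix w (a :: fill v z).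
    move: r0; rewrite /reach; case: ifPn => [_|/(fill_noNone v w) -> //] wi.
    rewrite !prefixE; case: (size w) wi => //= k wi.
    by rewrite (@take_fill v w) // ltnW // -subn_eq0 wi.
  by rewrite addn0 -addnA leq_add2l; exact: leq_trans (leq_addr _ _) IH.
have -> : marks (None :: z) = (marks z).+1 by [].
rewrite -[fill w _]/(w ++ fill w z) -[fill v _]/(v ++ fill v z).
have := occ_cat_leq w w (fill w z); have := leq_occ_cat w v (fill v z).
rewrite {1}/reach /=; lia.
Qed.

Lemma occ_fill v w z :
  (num_occ w (fill w z) <= num_occ w (fill v z) + 2 * size w * marks z)%N.
Proof. exact: leq_trans (leq_addr _ _) (occ_fill_reach v w z). Qed.

(** The marked words of length at most [M]; for [v] nonempty they include all
    [z] with [fill v z = x] as soon as [size x <= M]. *)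
Fixpoint markings M : seq (seq (option A)) :=
  if M is M'.+1 then
    [::] :: [seq None :: z | z <- markings M'] ++
            [seq Some a :: z | a <- enum A, z <- markings M']
  else [:: [::]].

Lemma big_markingsS (V : nmodType) (P : pred (seq (option A))) (F : _ -> V) M :
  \sum_(z <- markings M.+1 | P z) F z =
    (if P [::] then F [::] else 0) +
    (\sum_(z <- markings M | P (None :: z)) F (None :: z) +
     \sum_a \sum_(z <- markings M | P (Some a :: z)) F (Some a :: z)).
Proof.
rewrite /= big_cons big_cat big_map /=.
have -> : \sum_(z <- [seq Some a :: z | a <- enum A, z <- markings M] | P z) F z =
    \sum_a \sum_(z <- markings M | P (Some a :: z)) F (Some a :: z).
  rewrite big_mkcond big_allpairs_dep big_enum.
  by apply: eq_bigr => a _; rewrite [RHS]big_mkcond.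
by case: ifP => _; rewrite ?add0r.
Qed.

Section MarkingSum.
Context {R : realFieldType}.
Implicit Types (s t : R).

(** The generating polynomial of the sets of pairwise disjoint occurrences of
    [v] in [x], once [size x <= M]. *)
Definition marking_sum v s M x : R :=
  \sum_(z <- markings M | fill v z == x) s ^+ marks z.

Lemma marking_sum_nil v s M : (0 < size v)%N -> marking_sum v s M [::] = 1.
Proof.
move=> v0; rewrite /marking_sum; case: M => [|M].
  by rewrite big_cons big_nil addr0.
rewrite big_markingsS /= [X in _ + (X + _)]big1 => [|z]; last first.
  by rewrite /fill /=; case: (v) v0.
by rewrite big1 ?addr0 ?add0r // => a _; rewrite big1.
Qed.

(** Either the first letter is not in a chosen occurrence, or a chosen
    occurrence of [v] starts there. *)
Lemma marking_sum_cons v s M a x : (0 < size v)%N ->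
  marking_sum v s M.+1 (a :: x) = marking_sum v s M x +
    (if prefix v (a :: x) then s * marking_sum v s M (drop (size v) (a :: x)) else 0).
Proof.
move=> v0; rewrite /marking_sum big_markingsS /= add0r addrC; congr (_ + _).
  rewrite (bigD1 a) //= [X in _ + X]big1 ?addr0.
    by apply: eq_bigl => z; rewrite /fill /= eqseq_cons eqxx.
  by move=> b ba; rewrite big1 // => z; rewrite /fill /= eqseq_cons (negPf ba).
case: ifP => pv.
  rewrite big_distrr /=; apply: eq_big => z; last by rewrite exprS.
  have /prefixP[r ->] := pv.
  by rewrite drop_size_cat // /fill /= eqseq_cat // eqxx.
apply: big1 => z /eqP zE; move: pv; rewrite -zE /fill /=.
by rewrite prefix_prefix.
Qed.

Lemma marking_sum_fuel v s M N x : (0 < size v)%N ->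
  (size x <= M)%N -> (size x <= N)%N -> marking_sum v s M x = marking_sum v s N x.
Proof.
move=> v0; elim: M N x => [|M IH] N [|a x] //=; rewrite ?marking_sum_nil //.
case: N => //= N; rewrite !ltnS => xM xN.
rewrite !marking_sum_cons // (IH N) //; case: ifP => // _; congr (_ + _ * _).
by apply: IH; rewrite size_drop /=; lia.
Qed.

Lemma marking_sum_ge0 v s M x : 0 <= s -> 0 <= marking_sum v s M x.
Proof. by move=> s0; apply: sumr_ge0 => z _; rewrite exprn_ge0. Qed.

(** The right-hand side is the sum of [t ^+ #|S|] over all sets [S] of
    occurrences of [w], disjoint or not. *)
Lemma marking_sum_le w t M y : (0 < size w)%N -> 0 <= t ->
  marking_sum w t M y <= (1 + t) ^+ num_occ w y.
Proof.
move=> w0 t0; have t1 : 1 <= 1 + t by lra.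
elim: M y => [|M IH] [|a y].
- by rewrite marking_sum_nil // exprn_ege1.
- rewrite /marking_sum /= big_cons big_nil /=; apply: exprn_ge0; lra.
- by rewrite marking_sum_nil // exprn_ege1.
rewrite marking_sum_cons // occ_cons exprD; case: ifP => _; last first.
  by rewrite addr0 expr0 mul1r.
rewrite expr1 mulrDl mul1r; apply: lerD => //; apply: ler_wpM2l => //.
apply: le_trans (IH _) _; apply: ler_weXn2l => //.
by case: (w) w0 => //= b w' _; exact: occ_drop.
Qed.

Definition full_marking_sum v s x := marking_sum v s (size x) x.

Lemma full_marking_sum_cons v s a x : (0 < size v)%N ->
  full_marking_sum v s (a :: x) = full_marking_sum v s x +
    (if prefix v (a :: x) then s * full_marking_sum v s (drop (size v).-1 x) else 0).
Proof.
move=> v0; rewrite /full_marking_sum /= marking_sum_cons //; case: ifP => // _.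
congr (_ + _ * _); case: (size v) (v0) => //= k _.
by apply: marking_sum_fuel => //; rewrite size_drop leq_subr.
Qed.

Lemma full_marking_sum_cat v s y x : (0 < size v)%N -> 0 <= s ->
  full_marking_sum v s x <= full_marking_sum v s (y ++ x).
Proof.
move=> v0 s0; elim: y => //= a y IH; rewrite full_marking_sum_cons //.
apply: le_trans IH _; rewrite lerDl; case: ifP => // _.
by rewrite mulr_ge0 // marking_sum_ge0.
Qed.

(** A chosen occurrence starting at a given letter contributes a factor [s], and
    what remains is a choice in a shorter word. *)
Lemma full_marking_sum_drop v s k x : (0 < size v)%N -> 0 <= s ->
  full_marking_sum v s x <= (1 + s) ^+ k * full_marking_sum v s (drop k x).
Proof.
move=> v0 s0; have s1 : 1 <= 1 + s by lra.
elim: k x => [|k IH] x; first by rewrite drop0 expr0 mul1r.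
case: x => [|a x]; first by rewrite ler_peMl ?exprn_ege1 ?marking_sum_ge0.
rewrite /= exprS -mulrA.
apply: (@le_trans _ _ ((1 + s) * full_marking_sum v s x)); last first.
  by apply: ler_wpM2l; [lra|].
rewrite full_marking_sum_cons // mulrDl mul1r lerD2l; case: ifP => _; last first.
  by rewrite mulr_ge0 // marking_sum_ge0.
apply: ler_wpM2l => //.
rewrite -[leRHS](congr1 (full_marking_sum v s) (cat_take_drop (size v).-1 x)).
exact: full_marking_sum_cat.
Qed.

(** Choosing an occurrence of [v] at the first letter only forbids occurrences
    starting at the next [(size v).-1] letters, and these account for a factor
    of at most [(1 + s) ^+ (size v).-1]. So the disjointness condition changes
    the rate [s] per occurrence only to second order. *)
Lemma full_marking_sum_ge v s x : (0 < size v)%N -> 0 <= s ->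
  (1 + s / (1 + s) ^+ (size v).-1) ^+ num_occ v x <= full_marking_sum v s x.
Proof.
move=> v0 s0; have s1 : 0 < 1 + s by lra.
have sg : 0 <= s / (1 + s) ^+ (size v).-1 by rewrite divr_ge0 ?exprn_ge0 // ltW.
elim: x => [|a x IH]; first by rewrite occ_nil // /full_marking_sum marking_sum_nil.
rewrite full_marking_sum_cons // occ_cons exprD; case: ifP => _; last first.
  by rewrite expr0 mul1r addr0.
rewrite expr1 mulrDl mul1r; apply: lerD => //.
rewrite -mulrA; apply: ler_wpM2l => //.
rewrite mulrC ler_pdivrMr ?exprn_gt0 // [leRHS]mulrC.
exact: le_trans IH (full_marking_sum_drop _ _ _ _ _ _).
Qed.

End MarkingSum.
End Markings.

(** * The weighted count of replacements *)
Section Counting.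
Context {A : finType} {R : realFieldType}.
Implicit Types (v w x y : seq A) (z : seq (option A)).

Lemma size_markings M z : z \in markings M -> (size z <= M)%N.
Proof.
elim: M z => [|M IH] z /=; first by rewrite inE => /eqP ->.
rewrite inE mem_cat => /or3P[/eqP -> //|/mapP[y /IH ? -> //]|].
by move=> /allpairsP[[a y] /= [_ /IH ? ->]].
Qed.

Lemma sum_subsingleton_le (T : finType) (P : pred T) (c : R) :
  0 <= c -> (forall i j, P i -> P j -> i = j) ->
  \sum_(i | P i) c <= c.
Proof.
move=> c0 Pinj; case: (pickP P) => [i Pi|P0]; last by rewrite big_pred0.
rewrite (bigD1 i) //= big1 ?addr0 // => j /andP[Pj /eqP ji].
by case: ji; apply: Pinj.
Qed.

(** Both sides are compared with the total of the weights [g z] over marked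
    words [z]. When [fill w z = y] is fixed, the marks form a set of occurrences of
    [w] in [y], and [g z] is [b ^+ size y] times the probability of this set if
    occurrences are selected independently with odds [t]. When
    [fill v z = x] is fixed, each mark changes the length by [size w - size v]
    and creates at most [2 * size w] occurrences of [w], whence the factor [s]
    per mark. *)
Lemma weighted_count_le (L : pred (seq A)) v w (N : nat) (b t s : R) :
  (0 < size v)%N -> (0 < size w)%N -> 0 < b -> 0 < t ->
  (forall u r, L (u ++ v ++ r) -> L (u ++ w ++ r)) ->
  s = t * (b ^+ size w / b ^+ size v) / (1 + t) ^+ (2 * size w) ->
  \sum_(x : N.-tuple A | L x)
     b ^+ N * (1 + s / (1 + s) ^+ (size v).-1) ^+ num_occ v x / (1 + t) ^+ num_occ w x
  <= \sum_(k < (size w * N).+1) #|[pred y : k.-tuple A | L y]|%:R * b ^+ k.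
Proof.
move=> v0 w0 b0 t0 Lvw sE; have t1 : 0 < 1 + t by lra.
have s0 : 0 < s by rewrite sE !(mulr_gt0, invr_gt0, exprn_gt0).
pose g z := b ^+ size (fill w z) * t ^+ marks z / (1 + t) ^+ num_occ w (fill w z).
have g0 z : 0 <= g z by rewrite /g !(mulr_ge0, invr_ge0, exprn_ge0) // ltW.
have weight_ge (x : N.-tuple A) :
    b ^+ N * (1 + s / (1 + s) ^+ (size v).-1) ^+ num_occ v x / (1 + t) ^+ num_occ w x
    <= \sum_(z <- markings N | fill v z == x) g z.
  apply: (@le_trans _ _ (b ^+ N * full_marking_sum v s x / (1 + t) ^+ num_occ w x)).
    rewrite ler_pM2r ?invr_gt0 ?exprn_gt0 // ler_pM2l ?exprn_gt0 //.
    by rewrite full_marking_sum_ge // ltW.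
  rewrite /full_marking_sum size_tuple /marking_sum big_distrr big_distrl /=.
  apply: ler_sum => z /eqP zx.
  have sz : (size (fill w z) + size v * marks z = N + size w * marks z)%N.
    have := size_fill v z; have := size_fill w z; rewrite zx size_tuple; lia.
  have bE : b ^+ size (fill w z) = b ^+ N * (b ^+ size w / b ^+ size v) ^+ marks z.
    rewrite expr_div_n -!exprM mulrA -exprD -sz exprD mulfK //.
    by rewrite lt0r_neq0 // exprn_gt0.
  rewrite /g bE sE; set th := b ^+ _ / _; have th0 : 0 < th.
    by rewrite divr_gt0 ?exprn_gt0.
  rewrite [(_ / _) ^+ _]exprMn exprMn exprVn -exprM.
  rewrite [leLHS](_ : _ = b ^+ N * th ^+ marks z * t ^+ marks z *
    ((1 + t) ^- (2 * size w * marks z) / (1 + t) ^+ num_occ w x)); last by ring.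
  rewrite ler_pM2l ?mulr_gt0 ?exprn_gt0 //.
  rewrite -invfM lef_pV2 ?posrE ?mulr_gt0 ?exprn_gt0 // -exprD.
  apply: ler_weXn2l; first lra.
  by have := occ_fill v w z; rewrite zx; lia.
apply: (@le_trans _ _ (\sum_(x : N.-tuple A | L x)
    \sum_(z <- markings N | fill v z == x) g z)).
  by apply: ler_sum => x _; exact: weight_ge.
rewrite (exchange_big_dep (fun z => L (fill w z))) /=; last first.
  move=> x z Lx /eqP zx.
  by apply: (@fill_replace _ (fun y => L y) v w Lvw); rewrite zx.
pose G z (k : 'I_(size w * N).+1) :=
  \sum_(y : k.-tuple A | L y && (fill w z == y)) g z.
apply: (@le_trans _ _ (\sum_(z <- markings N) \sum_k G z k)).
  rewrite big_mkcond /= big_seq [leRHS]big_seq; apply: ler_sum => z zN.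
  have G0 k : 0 <= G z k by apply: sumr_ge0.
  case: ifP => Lz; last by apply: sumr_ge0.
  have zk : (size (fill w z) < (size w * N).+1)%N.
    have mz : (marks z <= size z)%N by apply: count_size.
    have := size_fill w z; have := size_markings _ _ zN.
    by move: mz w0; move: (size (fill w z)) (marks z) (size z) (size w) => *; nia.
  apply: (@le_trans _ _ (g z)).
    apply: sum_subsingleton_le => // x y /andP[_ /eqP xz] /andP[_ /eqP yz].
    by apply: val_inj; rewrite /= -xz -yz.
  rewrite (bigD1 (Ordinal zk)) //= -[leLHS]addr0.
  apply: lerD; last by apply: sumr_ge0.
  rewrite /G (bigD1 (in_tuple (fill w z))) /= ?Lz ?eqxx //.
  by rewrite lerDl sumr_ge0.
rewrite exchange_big /=; apply: ler_sum => k _.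
rewrite /G (exchange_big_dep (fun y : k.-tuple A => L y)) /=; last first.
  by move=> z y _ /andP[].
rewrite mulr_natl -sumr_const; apply: ler_sum => y Ly.
rewrite (eq_bigl (fun z => fill w z == y)); last by move=> z; rewrite Ly.
rewrite (eq_bigr (fun z => (b ^+ k / (1 + t) ^+ num_occ w y) * t ^+ marks z)).
  rewrite -big_distrr /= -mulrA ger_pMr ?exprn_gt0 // mulrC.
  rewrite ler_pdivrMr ?exprn_gt0 // mul1r.
  exact: marking_sum_le (ltW t0).
by move=> z /eqP zy; rewrite /g zy size_tuple mulrAC.
Qed.
End Counting.

(** * The language of a subshift *)
Section Words.
Context {A : alphabetType}.
Implicit Types (X : set (config A)) (x : config A) (s u r : seq A).

(** The language is taken here as a boolean predicate on sequences, since marked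
    words of the same length fill to words of different lengths. *)
Definition occurs X s : bool :=
  `[< exists2 x, X x & forall i, (i < size s)%N -> x i%:Z = nth point s i >].

Lemma prefix_wordP n x (y : n.-tuple A) :
  prefix_word n x = y <-> forall i, (i < n)%N -> x i%:Z = nth point y i.
Proof.
split=> [<- i ni|xy].
  by rewrite -[i in nth _ _ i]/(val (Ordinal ni)) -tnth_nth tnth_mktuple.
apply: eq_from_tnth => i; rewrite tnth_mktuple (tnth_nth point).
exact: xy.
Qed.

Lemma occursE X n (y : n.-tuple A) : occurs X y = (y \in lang X n).
Proof.
apply/idP/idP => [/asboolP[x Xx xy]|].
  apply/mem_set; exists x => //; apply/prefix_wordP => i ni.
  by apply: xy; rewrite size_tuple.
move=> /set_mem[x Xx /prefix_wordP xy]; apply/asboolP; exists x => // i.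
by rewrite size_tuple; apply: xy.
Qed.

Lemma shift_subshift X n x : is_subshift X -> X x -> X (zshift n x).
Proof. by move=> [_ _ /(_ n) E] Xx; rewrite -E; exists x. Qed.

Lemma zshiftK n x : zshift (- n) (zshift n x) = x.
Proof. by apply/funext => i; rewrite /zshift subrK. Qed.

(** Shift the occurrence of [v] to the origin and excise it: by assumption the
    same configuration arises by excising [w] from a point of [X], which after
    the inverse shift shows [u ++ w ++ r]. *)
Lemma occurs_replace X m n (v : m.-tuple A) (w : n.-tuple A) u r :
  is_subshift X -> extender X v `<=` extender X w ->
  occurs X (u ++ v ++ r) -> occurs X (u ++ w ++ r).
Proof.
move=> sX Evw /asboolP[x Xx xuvr].
have xl i : (i < size u)%N -> x i%:Z = nth point u i.
  by move=> ui; rewrite xuvr ?nth_cat ?ui // size_cat; lia.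
have xv i : (i < m)%N -> x (size u + i)%:Z = nth point v i.
  move=> im; rewrite xuvr ?nth_cat ?size_cat ?size_tuple; last by lia.
  by rewrite ltnNge leq_addr /= addKn im.
have xr i : (i < size r)%N -> x (size u + m + i)%:Z = nth point r i.
  move=> ir; rewrite xuvr ?nth_cat ?size_cat ?size_tuple; last by lia.
  by rewrite -addnA ltnNge leq_addr /= addKn ltnNge leq_addr /= addKn.
have [] := Evw (excise m (zshift (size u)%:Z x)).
  exists (zshift (size u)%:Z x) => //; split; first exact: shift_subshift.
  by apply/prefix_wordP => i im; rewrite /zshift -PoszD addnC xv.
move=> x' [Xx' /prefix_wordP x'w] /funeqP xx'; apply/asboolP.
exists (zshift (- (size u)%:Z) x'); first exact: shift_subshift.
move=> i; rewrite !size_cat size_tuple nth_cat => i_lt; rewrite /zshift.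
have [iu|ui] := ltnP i (size u).
  have := xx' (i%:Z - (size u)%:Z); rewrite /excise.
  rewrite (_ : _ < 0); last by lia.
  by move=> ->; rewrite /zshift subrK xl.
have -> : i%:Z - (size u)%:Z = (i - size u)%N%:Z by lia.
rewrite nth_cat size_tuple; have [iw|wi] := ltnP; first exact: x'w.
have := xx' (i - size u - n)%N; rewrite /excise /=.
have -> : (i - size u - n)%N%:Z + n%:Z = (i - size u)%N%:Z by rewrite -PoszD subnK.
move=> ->; rewrite /zshift -xr; last first.
  by move: i_lt wi ui; move: (size u) (size r) => su sr; lia.
by congr (x _); move: i_lt wi ui; move: (size u) (size r) => su sr; lia.
Qed.

End Words.

(** * Word frequencies of an invariant measure *)
Section Measure.
Context {R : realType} {A : alphabetType}.
Context (X : set (config A)) (mu : probability (config A) R).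
Context (sX : is_subshift X) (iX : is_invariant_on X mu).

Lemma measurable_open (B : set (config A)) : open B -> measurable B.
Proof. by move=> oB; apply: sub_sigma_algebra. Qed.

Lemma measurable_subshift : measurable X.
Proof.
case: sX => _ cX _; rewrite -[X]setCK; apply: measurableC.
by apply: measurable_open; rewrite openC.
Qed.

(** Stated for all shifts because invariance is applied to preimages of
    cylinders; the cylinders themselves are the case of the shift by [0]. *)
Lemma measurable_cylinder_at k {n} (y : n.-tuple A) :
  measurable (zshift k @^-1` cylinder X y).
Proof.
rewrite (_ : _ @^-1` _ = X `&`
  \bigcap_(i in [set: 'I_n]) [set x : config A | x (i%:Z + k) = tnth y i]).
  apply: measurableI; first exact: measurable_subshift.
  apply: fin_bigcap_measurable => [|i _]; first exact: finite_finset.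
  apply: measurable_open.
  have pc := @proj_continuous int (fun=> discrete_topology A) (i%:Z + k).
  exact: (iffLR (@continuousP (config A) (discrete_topology A)
    (fun x => x (i%:Z + k))) pc [set tnth y i] (discrete_open _)).
apply/seteqP; split=> x [Xx].
  move=> xy; split; first by rewrite -(zshiftK k x); exact: shift_subshift.
  by move=> i _ /=; rewrite -xy tnth_mktuple.
move=> xy; split; first exact: shift_subshift.
by apply: eq_from_tnth => i; rewrite tnth_mktuple; exact: xy.
Qed.

Lemma measurable_cylinder {n} (y : n.-tuple A) : measurable (cylinder X y).
Proof.
rewrite (_ : cylinder X y = zshift 0 @^-1` cylinder X y).
  exact: measurable_cylinder_at.
by apply/seteqP; split=> x; rewrite /preimage /=;
  (have -> : zshift 0 x = x by apply/funext => i; rewrite /zshift addr0).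
Qed.

Definition freq {n} (y : n.-tuple A) : R := fine (mu (cylinder X y)).

Lemma freq_ge0 {n} (y : n.-tuple A) : 0 <= freq y.
Proof. by apply: fine_ge0; exact: measure_ge0. Qed.

Lemma freqE {n} (y : n.-tuple A) : (freq y)%:E = mu (cylinder X y).
Proof. by rewrite fineK //; apply: fin_num_measure; exact: measurable_cylinder. Qed.

Lemma freq_occurs {n} (y : n.-tuple A) : ~~ occurs X y -> freq y = 0.
Proof.
move=> nXy; rewrite /freq (_ : cylinder X y = set0) ?measure0 //.
rewrite -subset0 => x [Xx xy]; move: nXy; rewrite occursE => /negP; apply.
by apply/mem_set; exists x.
Qed.

Lemma measure_partition n (B : set (config A)) :
  measurable B -> B `<=` X ->
  mu B = (\sum_(y : n.-tuple A) mu (B `&` cylinder X y))%E.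
Proof.
move=> mB BX; rewrite [RHS]bigfs ?index_enum_uniq //; last first.
  by move=> i _; rewrite mem_index_enum.
rewrite -measure_fin_bigcup.
- congr (mu _); apply/seteqP; split=> [x Bx|x [y _ []] //].
  by exists (prefix_word n x) => //; split => //; split=> //; exact: BX.
- exact: finite_finset.
- move=> y y' _ _ [x [[_ [_ xy]] [_ [_ xy']]]].
  by rewrite -xy -xy'.
- by move=> y _; apply: measurableI => //; exact: measurable_cylinder.
Qed.

Lemma sum_freq n : \sum_(y : n.-tuple A) freq y = 1.
Proof.
have [muX _] := iX; apply: EFin_inj; rewrite -muX -sumEFin.
rewrite (@measure_partition n X measurable_subshift) //.
apply: eq_bigr => y _; rewrite freqE; congr (mu _).
by apply/seteqP; split=> x; [case=> Xx xy; split|case].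
Qed.

(** The words with [v] at position [k] partition the preimage of the cylinder of
    [v] under the shift by [k], and this preimage has the same measure as the
    cylinder. *)
Lemma sum_freq_prefix {m} (v : m.-tuple A) N k : (k + m <= N)%N ->
  \sum_(x : N.-tuple A | prefix v (drop k x)) freq x = freq v.
Proof.
move=> kmN; have [_ /(_ k%:Z _ (measurable_cylinder v)) muv] := iX.
apply: EFin_inj; rewrite freqE -muv -sumEFin.
rewrite (@measure_partition N); last 2 first.
- exact: measurable_cylinder_at.
- by move=> x [Xx _]; rewrite -(zshiftK k%:Z x); exact: shift_subshift.
rewrite big_mkcond; apply: eq_bigr => x _; rewrite prefixE size_tuple.
suff P y : cylinder X x y ->
    (prefix_word m (zshift k y) = v) <-> take m (drop k x) = v.
  case: eqP => xv.
    rewrite freqE; congr (mu _); apply/seteqP; split => [y xy|y [] //].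
    split=> //; split; last by apply/(P y xy).
    by apply: shift_subshift => //; case: xy.
  rewrite (_ : _ `&` _ = set0) ?measure0 // -subset0 => y [[_ yv] xy].
  by apply: xv; apply/(P y xy).
move=> [Xy /prefix_wordP xy].
have E i : (i < m)%N -> nth point (take m (drop k x)) i = zshift k y i%:Z.
  move=> im; rewrite nth_take // nth_drop /zshift -PoszD addnC.
  by rewrite xy 1?addnC //; apply: leq_trans kmN; rewrite ltn_add2l.
rewrite prefix_wordP; split=> [yv|xv i im]; last by rewrite -xv E.
apply: (@eq_from_nth _ point).
  rewrite size_takel ?size_tuple //.
  by rewrite leq_subRL // (leq_trans (leq_addr _ _) kmN).
move=> i; rewrite size_takel ?size_drop ?size_tuple; last first.
  by rewrite leq_subRL // (leq_trans (leq_addr _ _) kmN).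
by move=> im; rewrite E // yv.
Qed.

(** The mean of the number of occurrences is the sum over positions of the
    probabilities of an occurrence there. *)
Lemma mean_occ {m} (v : m.-tuple A) N : (0 < m)%N ->
  \sum_(x : N.-tuple A) freq x * (num_occ v x)%:R =
  \sum_(k < N) if (k + m <= N)%N then freq v else 0.
Proof.
move=> m0.
rewrite (eq_bigr (fun x : N.-tuple A =>
    \sum_(k < N) if prefix v (drop k x) then freq x else 0)); last first.
  move=> x _; rewrite num_occE ?size_tuple // natr_sum big_distrr /=.
  by apply: eq_bigr => k _; case: (prefix _ _); rewrite ?mulr1 ?mulr0.
rewrite exchange_big; apply: eq_bigr => k _.
rewrite -big_mkcond; case: ifP => kN; first exact: sum_freq_prefix.
rewrite big_pred0 // => x; apply/negP => /size_prefix.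
by rewrite size_drop !size_tuple => h; move: kN; have := ltn_ord k; lia.
Qed.

Lemma mean_occ_le {m} (v : m.-tuple A) N : (0 < m)%N ->
  \sum_(x : N.-tuple A) freq x * (num_occ v x)%:R <= N%:R * freq v.
Proof.
move=> m0; rewrite mean_occ //.
apply: (@le_trans _ _ (\sum_(k < N) freq v)).
  by apply: ler_sum => k _; case: ifP => // _; exact: freq_ge0.
by rewrite sumr_const card_ord mulr_natl.
Qed.

Lemma mean_occ_ge {m} (v : m.-tuple A) N : (0 < m)%N ->
  (N%:R - m%:R) * freq v <= \sum_(x : N.-tuple A) freq x * (num_occ v x)%:R.
Proof.
move=> m0; rewrite mean_occ //; have f0 := freq_ge0 v.
have [mN|Nm] := leqP m N; last first.
  apply: (@le_trans _ _ 0); last by apply: sumr_ge0 => k _; case: ifP.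
  by rewrite mulr_le0_ge0 // subr_le0 ler_nat ltnW.
rewrite -(subnK mN); move: (N - m)%N => d.
rewrite natrD addrK big_split_ord /= -[leLHS]addr0.
apply: lerD; last by apply: sumr_ge0 => k _; case: ifP.
rewrite mulr_natl -[X in _ *+ X]card_ord -sumr_const; apply: ler_sum => k _.
by rewrite leq_add2r ltnW.
Qed.

End Measure.

(** * Entropy and growth estimates *)
Section Analysis.
Context {R : realType}.

(** The inequality of Gibbs: with [Q] the sum of [q], it is the mean of
    [ln u <= u - 1] for [u = q x / (Q * p x)]. *)
Lemma gibbs (T : finType) (D : pred T) (p q : T -> R) :
  (forall x, 0 <= p x) -> \sum_x p x = 1 ->
  (forall x, D x -> 0 < q x) -> (forall x, ~~ D x -> p x = 0) ->
  \sum_x - (p x * ln (p x)) + \sum_x p x * ln (q x) <= ln (\sum_(x | D x) q x).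
Proof.
move=> p0 p1 q0 pD; set Q := \sum_(x | D x) q x.
have Q0 : 0 < Q.
  have [x Dx|D0] := pickP D; last first.
    have := p1; rewrite big1 => [/eqP|x _]; first by rewrite eq_sym oner_eq0.
    by apply: pD; rewrite D0.
  rewrite /Q (bigD1 x) //= ltr_wpDr ?q0 //.
  by apply: sumr_ge0 => y /andP[/q0/ltW].
rewrite -subr_le0 -big_split /=.
have -> : ln Q = \sum_x p x * ln Q by rewrite -big_distrl /= p1 mul1r.
rewrite -sumrB.
have E0 : \sum_x ((if D x then q x else 0) / Q - p x) = 0.
  by rewrite sumrB p1 -big_distrl /= -big_mkcond /= divff ?subrr // gt_eqF.
rewrite -[leRHS]E0; apply: ler_sum => x _.
have [Dx|/pD ->] := boolP (D x); last by rewrite !mul0r; lra.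
have := p0 x; rewrite le_eqVlt => /orP[/eqP <-|px0].
  by rewrite !mul0r !oppr0 !addr0 divr_ge0 // ltW // q0.
have qx0 := q0 x Dx.
have u0 : 0 < q x / Q / p x by rewrite !divr_gt0.
have u1 : -1 < q x / Q / p x - 1 by lra.
have := le_ln1Dx u1; rewrite [1 + _]addrC subrK.
rewrite !ln_div ?posrE ?divr_gt0 // => h.
have := ler_wpM2l (ltW px0) h.
have -> : p x * (q x / Q / p x - 1) = q x / Q - p x.
  by rewrite mulrBr mulr1 mulrC divfK // gt_eqF.
by apply: le_trans; rewrite le_eqVlt; apply/orP; left; apply/eqP; ring.
Qed.

(** The value of [limn] is [0] on divergent sequences, so a positive value can
    only be a true limit. Positive entropy thus gives convergence of the
    sequences that define the two entropies. *)
Lemma cvg_limn_gt0 (u : R^nat) : 0 < limn u -> u @ \oo --> limn u.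
Proof.
have [cu|ncu] := pselect (cvgn u); first by [].
by rewrite (dvgP ncu) ltxx.
Qed.

Lemma bounded_slope (c C : R) (N0 : nat) :
  (forall N, (N0 <= N)%N -> N%:R * c <= C) -> c <= 0.
Proof.
move=> H; rewrite leNgt; apply/negP => c0.
have C0 : 0 <= `|C| / c by rewrite divr_ge0 // ltW.
have := archi_boundP C0; set M := Num.Def.archi_bound _ => CM.
have := H (maxn N0 M) (leq_maxl _ _).
apply/negP; rewrite -ltNge; apply: le_lt_trans (ler_norm C) _.
rewrite -ltr_pdivrMr //; apply: lt_le_trans CM _.
by rewrite ler_nat leq_maxr.
Qed.

(** Taking the weights a little smaller than the inverse of the exponential
    growth makes the sum over all lengths converge, so that words of different
    lengths can be treated together. *)
Lemma bounded_growth (a : nat -> nat) (h d : R) : 0 < d ->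
  n%:R^-1 * ln (a n)%:R @[n --> \oo] --> h ->
  exists2 G : R, 1 <= G & forall K,
    \sum_(k < K) (a k)%:R * expR (- (h + 2 * d)) ^+ k <= G.
Proof.
move=> d0 ah.
have hd : h < h + d by lra.
have [K0 _ HK] := cvgr_lt _ ah _ hd.
pose r := expR (- d); have r0 : 0 < r by exact: expR_gt0.
have r1 : r < 1 by rewrite /r -expR0 ltr_expR; lra.
pose c k := (a k)%:R * expR (- (h + 2 * d)) ^+ k.
have c0 k : 0 <= c k by rewrite mulr_ge0 // exprn_ge0 // expR_ge0.
have ck k : c k <= (if (k < K0.+1)%N then c k else 0) + r ^+ k.
  have rk0 : 0 <= r ^+ k by rewrite exprn_ge0 // ltW.
  case: ltnP => kK; first by rewrite lerDl.
  have k0 : (0 < k)%N by exact: leq_trans kK.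
  rewrite add0r /c; have [->|ak0] := posnP (a k); first by rewrite mul0r.
  have := HK k (ltnW kK); rewrite /= mulrC ltr_pdivrMr ?ltr0n // => ak.
  rewrite -[(a k)%:R]lnK ?posrE ?ltr0n // -!expRM_natl -expRD ler_expR.
  by move: ak; lra.
(* The terms up to [K0], then a geometric tail. *)
exists (1 + \sum_(k < K0.+1) c k + 1 / (1 - r)).
  have S0 : 0 <= \sum_(k < K0.+1) c k by apply: sumr_ge0.
  have : 0 <= 1 / (1 - r) by rewrite divr_ge0 // subr_ge0 ltW.
  lra.
move=> K; apply: (@le_trans _ _ (\sum_(k < K)
   ((if (k < K0.+1)%N then c k else 0) + r ^+ k))).
  by apply: ler_sum => k _; exact: ck.
rewrite big_split /=; apply: lerD.
  apply: (@le_trans _ _ (\sum_(k < K0.+1) c k)); last by rewrite lerDr.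
  have [KK|KK] := leqP K K0.+1.
    rewrite (big_ord_widen K0.+1 (fun k => if (k < K0.+1)%N then c k else 0)) //.
    rewrite big_mkcond /=; apply: ler_sum => k _.
    by case: ifP => // _; rewrite ltn_ord.
  by rewrite -big_mkcond /= (big_ord_widen K c) // ltnW.
have := @geometric_le_lim R K 1 r ler01 r0.
rewrite ger0_norm ?(ltW r0) // => /(_ r1); apply: le_trans.
rewrite /series /= big_mkord le_eqVlt; apply/orP; left; apply/eqP.
by apply: eq_bigr => k _; rewrite /geometric /= mul1r.
Qed.

End Analysis.

(** * The replacement inequality *)
Section Rate.
Context {R : realType} {A : alphabetType}.

(** Words of length [N] have entropy at least [N * (h - d)], their weights
    [b ^+ N] cost [N * (h + 2 * d)], which is the origin of [3 * d], and the
    total weight is bounded independently of [N]. Division by [N] leaves only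
    the two terms counting occurrences. *)
Lemma replacement_rate (X : set (config A)) (mu : probability (config A) R)
    (m n : nat) (v : m.-tuple A) (w : n.-tuple A) (d t b s : R) :
  is_subshift X -> 0 < htop R X -> is_MME X mu ->
  (0 < m)%N -> (0 < n)%N -> extender X v `<=` extender X w ->
  0 < d -> 0 < t -> b = expR (- (htop R X + 2 * d)) ->
  s = t * (b ^+ n / b ^+ m) / (1 + t) ^+ (2 * n) ->
  freq X mu v * ln (1 + s / (1 + s) ^+ m.-1) <=
  freq X mu w * ln (1 + t) + 3 * d.
Proof.
move=> sX h0 [iX hX] m0 n0 Evw d0 t0 bE sE; set h := htop R X in h0 hX bE *.
have b0 : 0 < b by rewrite bE expR_gt0.
have t1 : 0 < 1 + t by lra.
have s0 : 0 < s by rewrite sE !(mulr_gt0, invr_gt0, exprn_gt0).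
have s1 : 0 < 1 + s by lra.
set sg := s / _; have sg0 : 0 < sg by rewrite divr_gt0 ?exprn_gt0.
have sg1 : 0 < 1 + sg by lra.
have [G G1 HG] := @bounded_growth R (fun k => #|lang X k|) h d d0
  (cvg_limn_gt0 _ h0).
have hm0 : 0 < hmeas X mu by rewrite hX.
have hmh : h - d < hmeas X mu by rewrite hX -/h; lra.
have [N0 _ HN] := cvgr_gt _ (cvg_limn_gt0 _ hm0) _ hmh.
(* It suffices that all large multiples of [c] are bounded by one constant. *)
rewrite -subr_le0; set c := _ - _.
apply: (@bounded_slope R c
  (ln G + m%:R * (freq X mu v * ln (1 + sg))) N0.+1) => N NN.
have N_gt0 : (0 < N)%N by exact: leq_trans NN.
have := HN N (ltnW NN); rewrite /= mulrC ltr_pdivlMr ?ltr0n // => HNN.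
pose q (x : N.-tuple A) := b ^+ N * (1 + sg) ^+ num_occ v x / (1 + t) ^+ num_occ w x.
have q0 x : 0 < q x by rewrite /q divr_gt0 ?mulr_gt0 ?exprn_gt0.
have Hc := @gibbs R _ (fun x : N.-tuple A => occurs X x) (freq X mu) q
  (fun x => freq_ge0 _ _ x) (sum_freq _ _ sX iX N) (fun x _ => q0 x)
  (fun x => freq_occurs _ _ x).
have QG : ln (\sum_(x : N.-tuple A | occurs X x) q x) <= ln G.
  have [Q0|Q0] := leP (\sum_(x : N.-tuple A | occurs X x) q x) 0.
    by rewrite ln0 // ln_ge0.
  rewrite ler_ln ?posrE ?(lt_le_trans _ G1) //.
  apply: le_trans (HG (size w * N).+1).
  have := weighted_count_le (occurs X) v w N b t s.
  rewrite !size_tuple => /(_ m0 n0 b0 t0).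
  move=> /(_ (fun u r => @occurs_replace _ X _ _ v w u r sX Evw) sE) /le_trans; apply.
  rewrite le_eqVlt; apply/orP; left; apply/eqP; apply: eq_bigr => k _.
  by rewrite bE; congr (_%:R * _); apply: eq_card => y; rewrite -occursE.
have lnq x : ln (q x) = N%:R * - (h + 2 * d) + (num_occ v x)%:R * ln (1 + sg)
     - (num_occ w x)%:R * ln (1 + t).
  rewrite /q ln_div ?posrE ?mulr_gt0 ?exprn_gt0 // lnM ?posrE ?exprn_gt0 //.
  by rewrite !lnXn // bE expRK !mulr_natl.
have lnv : 0 <= ln (1 + sg) by rewrite ln_ge0 //; lra.
have lnw : 0 <= ln (1 + t) by rewrite ln_ge0 //; lra.
have : \sum_x freq X mu x * ln (q x) = N%:R * - (h + 2 * d) +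
    (\sum_(x : N.-tuple A) freq X mu x * (num_occ v x)%:R) * ln (1 + sg) -
    (\sum_(x : N.-tuple A) freq X mu x * (num_occ w x)%:R) * ln (1 + t).
  have -> : N%:R * - (h + 2 * d) =
      \sum_(x : N.-tuple A) freq X mu x * (N%:R * - (h + 2 * d)).
    by rewrite -big_distrl /= (sum_freq X mu sX iX N) mul1r.
  rewrite !big_distrl -big_split -sumrB /=.
  by apply: eq_bigr => x _; rewrite lnq; ring.
have := ler_wpM2r lnv (mean_occ_ge X mu sX iX v N m0).
have := ler_wpM2r lnw (mean_occ_le X mu sX iX w N n0).
rewrite /c; move: HNN Hc QG.
have -> : \sum_(y : N.-tuple A)
    - (fine (mu (cylinder X y)) * ln (fine (mu (cylinder X y)))) =
  \sum_(x : N.-tuple A) - (freq X mu x * ln (freq X mu x)) by [].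
(* What remains is arithmetic in these sums and logarithms. *)
move: (\sum_(x : N.-tuple A) - _) (\sum_x _ * ln (q x)) (\sum_x _ * _%:R)
 (\sum_x _ * _%:R) (ln G) (ln (\sum_(x | _) _)) (ln (1 + sg)) (ln (1 + t)) => *.
nra.
Qed.

End Rate.

Lemma ln1D_ge (R : realType) (x : R) : -1 < x -> x / (1 + x) <= ln (1 + x).
Proof.
move=> x0; have x1 : 0 < 1 + x by lra.
have u1 : -1 < (1 + x)^-1 - 1 by rewrite ltrBrDr addNr invr_gt0.
have := le_ln1Dx u1; rewrite [1 + (_ - _)]addrC subrK lnV ?posrE //.
have -> : x / (1 + x) = 1 - (1 + x)^-1 by field; rewrite gt_eqF.
by rewrite lerNl opprB.
Qed.

(** The choice [d = t * t] makes the error term small compared with [t], by which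
    both sides are divided. The quotients are moved to the right, where they
    become factors whose limits as [t] tends to [0] are clear. *)
Lemma freq_le_approx (R : realType) (A : alphabetType) (X : set (config A))
    (mu : probability (config A) R) (m n : nat) (v : m.-tuple A) (w : n.-tuple A)
    (t : R) :
  is_subshift X -> 0 < htop R X -> is_MME X mu ->
  (0 < m)%N -> (0 < n)%N -> extender X v `<=` extender X w -> 0 < t ->
  freq X mu v <= (freq X mu w + 3 * t) *
    expR ((htop R X + 2 * (t * t)) * (n%:R - m%:R)) * (1 + t) ^+ (2 * n) *
    (1 + t * expR (- ((htop R X + 2 * (t * t)) * (n%:R - m%:R)))) ^+ m.
Proof.
move=> sX h0 MX m0 n0 Evw t0; set e := _ * (n%:R - m%:R).
have t1 : 0 < 1 + t by lra.
have eE : expR (- (htop R X + 2 * (t * t))) ^+ n /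
    expR (- (htop R X + 2 * (t * t))) ^+ m = expR (- e).
  by rewrite -!expRM_natl -expRN -expRD; congr expR; rewrite /e; ring.
pose T := (1 + t) ^+ (2 * n); have T1 : 1 <= T by rewrite exprn_ege1 //; lra.
pose s := t * expR (- e) / T.
have := @replacement_rate R A X mu m n v w (t * t) t _ s sX h0 MX m0 n0 Evw
  (mulr_gt0 t0 t0) t0 erefl.
rewrite eE => /(_ erefl).
have s0 : 0 < s by rewrite /s !(mulr_gt0, invr_gt0, expR_gt0, exprn_gt0).
have s1 : 0 < 1 + s by lra.
set S := (1 + s) ^+ m.-1; have S1 : 1 <= S by rewrite exprn_ege1 //; lra.
have sg0 : 0 < s / S by rewrite divr_gt0 //; lra.
have fv := freq_ge0 X mu v; have fw := freq_ge0 X mu w.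
move=> H.
have {H} H : freq X mu v * (s / S / (1 + s / S)) <= t * (freq X mu w + 3 * t).
  have := ler_wpM2l fv (ln1D_ge _ _ (lt_trans (ltrN10 R) sg0)).
  have t1' : -1 < t by lra.
  have := ler_wpM2l fw (le_ln1Dx t1'); lra.
have {H} H : freq X mu v * s <= t * (freq X mu w + 3 * t) * (1 + s) ^+ m.
  rewrite -ler_pdivrMr ?exprn_gt0 // -mulrA; apply: le_trans H.
  apply: ler_wpM2l => //; rewrite -(prednK m0) exprSr -/S.
  have -> : s / S / (1 + s / S) = s / (S + s) by field; lra.
  rewrite ler_pM2l // lef_pV2 ?posrE ?mulr_gt0 //; [|lra|lra].
  by rewrite mulrDr mulr1 lerD2l ler_peMl // ltW.
have {H} H : freq X mu v * expR (- e) <=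
    (freq X mu w + 3 * t) * T * (1 + s) ^+ m.
  have T0 : 0 < T by lra.
  move: H; rewrite [X in _ * X <= _](_ : s = t * (expR (- e) / T)); last first.
    by rewrite /s mulrA.
  by rewrite mulrCA -[leRHS]mulrA ler_pM2l // mulrA ler_pdivrMr // mulrAC.
apply: (@le_trans _ _ ((freq X mu w + 3 * t) * T * (1 + s) ^+ m * expR e)).
  by rewrite -ler_pdivrMr ?expR_gt0 // -expRN.
rewrite -/T [leRHS]mulrAC [leRHS](_ : _ = (freq X mu w + 3 * t) * T *
  (1 + t * expR (- e)) ^+ m * expR e); last by ring.
rewrite ler_pM2r ?expR_gt0 //; apply: ler_wpM2l; first by rewrite mulr_ge0; lra.
have te0 : 0 <= t * expR (- e) by rewrite mulr_ge0 ?expR_ge0 // ltW.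
have sle : s <= t * expR (- e) by rewrite /s ler_pdivrMr ?ler_peMr //; lra.
by apply: lerXn2r; rewrite ?nnegrE; lra.
Qed.

Theorem theorem3p11 (R : realType) (A : alphabetType) (X : set (config A))
    (mu : probability (config A) R)
    (m n : nat) (v : m.-tuple A) (w : n.-tuple A)
    (subX : is_subshift X) (htop_gt0 : 0 < htop R X) (mmeX : is_MME X mu)
    (m_gt0 : (0 < m)%N) (n_gt0 : (0 < n)%N)
    (vL : lang X m v) (wL : lang X n w)
    (Evw : extender X v `<=` extender X w) :
  (mu (cylinder X v) <=
   mu (cylinder X w) * (expR (htop R X * (n%:R - m%:R)))%:E)%E.
Proof.
rewrite -(freqE X mu subX v) -(freqE X mu subX w) -EFinM lee_fin.
set h := htop R X; set k := n%:R - m%:R.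
pose F t := (freq X mu w + 3 * t) * expR ((h + 2 * (t * t)) * k) *
  (1 + t) ^+ (2 * n) * (1 + t * expR (- ((h + 2 * (t * t)) * k))) ^+ m.
have F0 : F 0 = freq X mu w * expR (h * k).
  by rewrite /F !(mulr0, mul0r, addr0) !expr1n !mulr1.
have cF : F t @[t --> 0^'+] --> F 0.
  apply: cvg_at_right_filter.
  have ct : t @[t --> (0 : R)] --> (0 : R) by exact: cvg_id.
  have cC (c : R) : (fun=> c) @ (0 : R) --> c by exact: cvg_cst.
  have ce : (h + 2 * (t * t)) * k @[t --> (0 : R)] --> (h + 2 * (0 * 0)) * k.
    exact: (cvgM (cvgD (cC h) (cvgM (cC 2) (cvgM ct ct))) (cC k)).
  have cexp (f : R -> R) (l : R) : f t @[t --> (0 : R)] --> l ->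
      expR (f t) @[t --> (0 : R)] --> expR l.
    by move=> fl; apply: (continuous_cvg _ _ fl); exact: continuous_expR.
  have cX p (f : R -> R) (l : R) : f t @[t --> (0 : R)] --> l ->
      f t ^+ p @[t --> (0 : R)] --> l ^+ p.
    move=> fl.
    exact: (cvg_comp _ (fun x : R => x ^+ p) fl (@exprn_continuous R p l)).
  have c1 : freq X mu w + 3 * t @[t --> (0 : R)] --> freq X mu w + 3 * 0.
    exact: (cvgD (cC _) (cvgM (cC 3) ct)).
  have c2 : 1 + t @[t --> (0 : R)] --> (1 + 0 : R) by exact: (cvgD (cC 1) ct).
  have c3 : 1 + t * expR (- ((h + 2 * (t * t)) * k)) @[t --> (0 : R)] -->
      1 + 0 * expR (- ((h + 2 * (0 * 0)) * k)).
    exact: (cvgD (cC 1) (cvgM ct (cexp _ _ (cvgN ce)))).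
  exact: (cvgM (cvgM (cvgM c1 (cexp _ _ ce)) (cX _ _ _ c2)) (cX _ _ _ c3)).
rewrite -F0; apply: (cvgr_to_ge cF); near=> t.
exact: freq_le_approx.
Unshelve. all: by end_near. Qed.
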